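(* Let $\{a_k\}_{k=0}^{\infty}$ be a sequence of complex numbers and let $b_n = \sum_{k=0}^{n}\binom{n}{k}(-1)^{k-1}a_k$ for $n\ge 0$. Then for every integer $n\geq 1$, $$\sum_{k=1}^{n}\binom{n}{k}(-1)^{k-1}k\,\nabla a_k=n\,b_n .$$
   Context: The binomial transform of a sequence $\{a_k\}_{k\ge0}$ is the sequence $\{b_n\}_{n\ge0}$ with $b_n=\sum_{k=0}^{n}\binom{n}{k}(-1)^{k-1}a_k$ (the $k=0$ factor $(-1)^{-1}$ equals $-1$). The backward difference is $\nabla a_k=a_k-a_{k-1}$ for $k\ge1$. *)

(* Defs.v *)
From mathcomp Require Import all_boot all_order all_algebra.
From mathcomp Require Import reals complex.
Set Implicit Arguments.
Unset Strict Implicit.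
Unset Printing Implicit Defensive.
Import GRing.Theory.
Local Open Scope ring_scope.

(* The exponent k - 1 is an integer, so the k = 0 factor is (-1)^-1 = -1. *)
Definition binomial_transform (K : unitRingType) (a : nat -> K) (n : nat) : K :=
  \sum_(0 <= k < n.+1) 'C(n, k)%:R * (-1) ^ (k%:Z - 1) * a k.

(* Meaningful for k >= 1 only; k.-1 makes the value at k = 0 equal to 0. *)
Definition backward_diff (K : zmodType) (a : nat -> K) (k : nat) : K :=
  a k - a k.-1.

(* Main.v *)
Require Import Defs.
From mathcomp Require Import all_boot all_order all_algebra.
From mathcomp Require Import reals complex.
Import GRing.Theory.
Local Open Scope ring_scope.
Local Open Scope complex_scope.

(** Write [n = m + 1].  Pascal's rule splits the coefficient ['C(m + 1, k)] of
    the binomial transform into ['C(m, k)] and ['C(m, k - 1)].  Shifting the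
    index in the second part moves the alternating sign by one, so that the two
    parts combine into the differences [a (j + 1) - a j], weighted by
    [(-1) ^ j * 'C(m, j)] ([binomial_transformS]).  The absorption identity
    [k * 'C(m + 1, k) = (m + 1) * 'C(m, k - 1)] turns the weighted sum of
    backward differences into [m + 1] times the same sum. *)

Lemma signz_pred (K : unitRingType) (k : nat) :
  (-1 : K) ^ (k%:Z - 1) = - (-1) ^+ k.
Proof.
case: k => [|j]; first by rewrite sub0r expr0 exprN1 invrN1.
by rewrite intS addrC addKr exprS mulN1r opprK.
Qed.

(** Pascal's rule in terms of the transform: one step in the index amounts,
    up to sign, to taking the forward difference of the sequence. *)
Lemma binomial_transformS (K : unitRingType) (a : nat -> K) (m : nat) :
  binomial_transform a m.+1 =
  \sum_(0 <= j < m.+1) 'C(m, j)%:R * (-1) ^+ j * (a j.+1 - a j).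
Proof.
rewrite /binomial_transform big_nat_recl //= signz_pred !bin0 expr0.
under eq_bigr => j _ do
  rewrite signz_pred exprS mulN1r opprK binS natrD !mulrDl.
under [RHS]eq_bigr => j _ do rewrite mulrBr.
rewrite big_split sumrB /= addrA addrC; congr (_ + _).
(* The terms from ['C(m, k)] with [k >= 1]: the top one, at [k = m + 1],
   vanishes, and the [k = 0] term of the transform supplies the missing one. *)
rewrite big_nat_recr //= bin_small // !mul0r addr0.
rewrite [in RHS]big_nat_recl //= bin0 expr0 opprD mulrN !mulNr; congr (_ + _).
rewrite -sumrN; apply: eq_bigr => j _.
by rewrite exprS mulN1r mulrN mulNr opprK.
Qed.

Lemma sum_bin_backward_diff (K : unitRingType) (a : nat -> K) (n : nat) :
  \sum_(1 <= k < n.+1)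
     'C(n, k)%:R * (-1) ^ (k%:Z - 1) * k%:R * backward_diff a k
  = n%:R * binomial_transform a n.
Proof.
case: n => [|m]; first by rewrite big_geq // mul0r.
rewrite binomial_transformS mulr_sumr big_add1; apply: eq_bigr => j _.
rewrite /backward_diff signz_pred exprS mulN1r opprK -mulrA.
(* Absorption: [(j + 1) * 'C(m + 1, j + 1) = (m + 1) * 'C(m, j)]. *)
rewrite [RHS]mulrA [in RHS]mulrA -natrM mul_bin_diag natrM.
by rewrite !mulrA -(mulrA _ _ j.+1%:R) (commr_nat _ j.+1) mulrA -!natrM mulnC.
Qed.

Theorem corollary2 (R : realType) (a : nat -> R[i]) (n : nat) (hn : (1 <= n)%N) :
  \sum_(1 <= k < n.+1)
     'C(n, k)%:R * (-1) ^ (k%:Z - 1) * k%:R * backward_diff a k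
  = n%:R * binomial_transform a n.
Proof. exact: sum_bin_backward_diff. Qed.
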